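(* Let $A_4$ be the alternating group on four letters. Then $\mathcal S(A_4)=\mathcal S_{\mathrm{even}}\cup\mathcal S_{\mathrm{odd}}$, where $$\mathcal S_{\mathrm{even}}=\{2^a3^bm : a=4 \text{ or } a\ge 8;\ b=0\text{ or } b\ge 2;\ m\in\mathbb Z,\ \gcd(m,6)=1\}$$ and $$\mathcal S_{\mathrm{odd}}=\{m\in\mathbb Z : m\equiv 1\pmod 4,\ \text{and either } 3\nmid m \text{ or } 3^2\mid m\}.$$
   Context: For a finite group $G=\{g_1,\dots,g_n\}$, assign an independent variable $x_g$ to each $g\in G$; the group determinant $\mathscr D_G(x_{g_1},\dots,x_{g_n})$ is the determinant of the $n\times n$ matrix whose $(i,j)$ entry is $x_{g_ig_j^{-1}}$. Define $\mathcal S(G)=\{\mathscr D_G(x_{g_1},\dots,x_{g_n}) : x_{g_i}\in\mathbb Z\}$.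
   Formalization: The set equality fails at 0: all variables zero gives determinant 0, which lies in neither S_even nor S_odd; the formal theorem states S(A_4) = {0} ∪ S_even ∪ S_odd, with S_even and S_odd unchanged. *)

(* Defs.v *)
From mathcomp Require Import all_boot all_order all_algebra all_fingroup.
From mathcomp Require Import all_solvable.
From mathcomp Require Import boolp classical_sets.

Set Implicit Arguments.
Unset Strict Implicit.
Unset Printing Implicit Defensive.

Import GRing.Theory.

Local Open Scope ring_scope.

(* G is listed as g_i := enum_val i; the determinant does not depend on the   *)
(* order of the list.  The values of x outside of G play no role.             *)
Definition group_determinant (R : comNzRingType) (gT : finGroupType)
    (G : {group gT}) (x : gT -> R) : R :=
  \det (\matrix_(i < #|G|, j < #|G|)
    x (enum_val i * (enum_val j)^-1)%g).

Definition integer_group_determinants (gT : finGroupType) (G : {group gT}) :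
    set int :=
  [set d | exists x : gT -> int, d = group_determinant G x]%classic.

(* Neither S_even nor S_odd contains 0, although 0 is the determinant at      *)
(* x = 0: together they describe the nonzero determinants of A_4.             *)
Definition S_even : set int :=
  [set d | exists (a b : nat) (m : int),
     [/\ a = 4%N \/ (8 <= a)%N,
         b = 0%N \/ (2 <= b)%N,
         gcdz m 6 = 1
       & d = 2 ^+ a * 3 ^+ b * m]]%classic.

Definition S_odd : set int :=
  [set m | (m = 1 %[mod 4])%Z /\ (~~ (3 %| m)%Z \/ (3 ^+ 2 %| m)%Z)]%classic.

(* Main.v *)
(** Listing A_4 as c^k v with c of order 3 and v in the Klein group V, the
    matrix of the group determinant is a V-circulant array of 3 x 3 blocks.
    Diagonalising over the four characters of V gives D = L Q^3, where L is
    the circulant determinant of the three coset sums and the nontrivial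
    characters, permuted by c, contribute the same factor Q.  Since 3 | L
    implies 9 | L, 3 never divides D exactly.  Since L = Q mod 4: if Q is odd
    then D = Q^4 = 1 mod 4, if Q = 2 mod 4 then 2^4 divides D exactly, and
    otherwise 2^8 | D.  Conversely adding a constant t to all variables fixes Q
    and translates L, so nine small vectors with Q in {1, 2, 4} reach
    everything. *)

Require Import Defs.
From mathcomp Require Import all_boot all_order all_algebra all_fingroup.
From mathcomp Require Import all_solvable.
From mathcomp Require Import boolp classical_sets.
From mathcomp Require Import zify ring.

Set Implicit Arguments.
Unset Strict Implicit.
Unset Printing Implicit Defensive.

Import Order.TTheory GRing.Theory Num.Theory.
Local Open Scope ring_scope.

(** * Determinants under reindexing and of block matrices *)

(** The same permutation acts on rows and columns, so its sign occurs twice and cancels. Two sizes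
    are allowed because [#|G|] and its numeral are only provably equal. *)
Lemma det_reindex (R : comNzRingType) m n (f : 'I_m -> 'I_n) (A : 'M[R]_n) :
  bijective f -> \det (\matrix_(i, j) A (f i) (f j)) = \det A.
Proof.
move=> bf; have emn : m = n.
  by rewrite -[m]card_ord -[n]card_ord (bij_eq_card bf).
case: n / emn in f A bf *.
have -> : \matrix_(i, j) A (f i) (f j)
    = row_perm (perm (bij_inj bf)) (col_perm (perm (bij_inj bf)) A).
  by apply/matrixP => i j; rewrite !mxE !permE.
rewrite row_permE col_permE !det_mulmx !det_perm odd_permV.
by rewrite mulrC -mulrA -signr_addb addbb mulr1.
Qed.

Lemma group_determinant_enum (R : comNzRingType) (gT : finGroupType)
    (G : {group gT}) n (e : 'I_n -> gT) (x : gT -> R) :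
    injective e -> (forall i, e i \in G) -> #|G| = n ->
  group_determinant G x = \det (\matrix_(i, j) x (e i * (e j)^-1)%g).
Proof.
move=> einj eG cardG; pose f i := enum_rank_in (eG i) (e i).
have fE i : enum_val (f i) = e i by rewrite enum_rankK_in.
have finj : injective f by move=> i j /(congr1 enum_val); rewrite !fE => /einj.
have fbij : bijective f by apply: inj_card_bij; rewrite ?card_ord ?cardG.
rewrite /group_determinant -(det_reindex _ fbij); congr (\det _).
by apply/matrixP => i j; rewrite !mxE !fE.
Qed.

(** Adding the second block row to the first, then subtracting the first block column from the
    second, gives a block triangular matrix; no division by 2 occurs. *)
Lemma det_block_swap (R : comNzRingType) n (A B : 'M[R]_n) :
  \det (block_mx A B B A) = \det (A + B) * \det (A - B).
Proof.
have E : block_mx 1%:M 1%:M 0 1%:M *m block_mx A B B A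
    *m block_mx 1%:M (- 1%:M) 0 1%:M = block_mx (A + B) 0 B (A - B).
  rewrite !mulmx_block !(mul1mx, mulmx1, mul0mx, mulmx0, addr0, add0r) !mulmxN.
  by rewrite !mulmx1 [B + A]addrC addNr [- B + A]addrC.
have := congr1 (fun M => \det M) E.
by rewrite !det_mulmx !det_ublock det_lblock !det1 !mulr1 mul1r.
Qed.

Lemma det_klein_block (R : comNzRingType) n (Z0 Z1 Z2 Z3 : 'M[R]_n) :
  \det (block_mx (block_mx Z0 Z1 Z1 Z0) (block_mx Z2 Z3 Z3 Z2)
                 (block_mx Z2 Z3 Z3 Z2) (block_mx Z0 Z1 Z1 Z0))
  = \det (Z0 + Z2 + (Z1 + Z3)) * \det (Z0 + Z2 - (Z1 + Z3))
    * (\det (Z0 - Z2 + (Z1 - Z3)) * \det (Z0 - Z2 - (Z1 - Z3))).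
Proof.
by rewrite det_block_swap opp_block_mx !add_block_mx !det_block_swap.
Qed.

Lemma det_mx33 (R : comNzRingType) (E : nat -> nat -> R) (M : 'M[R]_3) :
    (forall i j, M i j = E i j) ->
  \det M
  = E 0%N 0%N * (E 1%N 1%N * E 2%N 2%N - E 1%N 2%N * E 2%N 1%N)
    - E 0%N 1%N * (E 1%N 0%N * E 2%N 2%N - E 1%N 2%N * E 2%N 0%N)
    + E 0%N 2%N * (E 1%N 0%N * E 2%N 1%N - E 1%N 1%N * E 2%N 0%N).
Proof.
move=> ME; rewrite (expand_det_row _ 0) !big_ord_recl big_ord0 /cofactor.
rewrite !(expand_det_row _ 0) !big_ord_recl !big_ord0 /cofactor !det_mx11.
rewrite !mxE !ME /= /bump /=; ring.
Qed.

(** * Coordinates on A_4 *)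

Definition c3 : {perm 'I_4} :=
  (tperm (Ordinal (isT : 1 < 4)%N) (Ordinal (isT : 2 < 4)%N)
   * tperm (Ordinal (isT : 1 < 4)%N) (Ordinal (isT : 3 < 4)%N))%g.

(** The two bits of [p] are exponents of two generating double transpositions, so multiplication
    becomes bitwise exclusive or. *)
Definition klein (p : nat) : {perm 'I_4} :=
  ((tperm (Ordinal (isT : 0 < 4)%N) (Ordinal (isT : 1 < 4)%N)
    * tperm (Ordinal (isT : 2 < 4)%N) (Ordinal (isT : 3 < 4)%N)) ^+ (p %% 2)
   * (tperm (Ordinal (isT : 0 < 4)%N) (Ordinal (isT : 2 < 4)%N)
    * tperm (Ordinal (isT : 1 < 4)%N) (Ordinal (isT : 3 < 4)%N)) ^+ (p %/ 2))%g.

Definition xor4 (p q : nat) : nat :=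
  ((p + q) %% 2 + 2 * ((p %/ 2 + q %/ 2) %% 2))%N.

(** Conjugation by [c3], read on the indices of [klein]. *)
Definition rot3 (p : nat) : nat := nth 0%N [:: 0; 3; 1; 2]%N p.

Ltac perm4 :=
  apply/permP => -[[|[|[|[|]]]] ?] //;
  rewrite ?(expgS, expg0, mulg1, permM, permE) /=; exact: val_inj.

Lemma c3_order : (c3 ^+ 3 = 1)%g.
Proof. perm4. Qed.

Lemma klein_mul p q : (p < 4)%N -> (q < 4)%N ->
  (klein p * klein q = klein (xor4 p q))%g.
Proof.
by case: p => [|[|[|[|//]]]] _; case: q => [|[|[|[|//]]]] _; perm4.
Qed.

Lemma c3_klein p : (p < 4)%N -> (c3 * klein p = klein (rot3 p) * c3)%g.
Proof. by case: p => [|[|[|[|//]]]] _; perm4. Qed.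

Lemma xor4_lt p q : (xor4 p q < 4)%N.
Proof. rewrite /xor4; lia. Qed.

Lemma klein_divg p q : (p < 4)%N -> (q < 4)%N ->
  (klein p * (klein q)^-1 = klein (xor4 p q))%g.
Proof.
move=> p4 q4; apply: (canLR (mulgK _)); rewrite klein_mul ?xor4_lt //.
congr (klein _).
by case: p p4 => [|[|[|[|//]]]] _; case: q q4 => [|[|[|[|//]]]].
Qed.

Lemma rot3_lt p : (rot3 p < 4)%N.
Proof. by case: p => [|[|[|[|p]]]] //; rewrite /rot3 /= nth_nil. Qed.

Lemma iter_rot3_lt l p : (p < 4)%N -> (iter l rot3 p < 4)%N.
Proof. by case: l => [|l] //= _; apply: rot3_lt. Qed.

Lemma klein_c3V l p : (p < 4)%N ->
  (klein p * (c3 ^+ l)^-1 = (c3 ^+ l)^-1 * klein (iter l rot3 p))%g.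
Proof.
move=> p4; apply: (canLR (mulgK _)); rewrite -mulgA; apply: (canRL (mulKg _)).
elim: l => [|l IH]; first by rewrite expg0 mul1g mulg1.
by rewrite expgS -mulgA IH mulgA c3_klein ?iter_rot3_lt // !mulgA.
Qed.

(* Every element of A_4 is c3^k * klein p for a unique pair k < 3, p < 4,     *)
(* encoded as the number k + 3 * p.                                           *)
Definition alt4 (i : nat) : {perm 'I_4} := (c3 ^+ (i %% 3) * klein (i %/ 3))%g.

(* An element of A_4 is determined by its values at 0 and 1. *)
Definition alt4_index (s : {perm 'I_4}) : nat :=
  index (val (s (Ordinal (isT : 0 < 4)%N)), val (s (Ordinal (isT : 1 < 4)%N)))
    [:: (0, 1); (0, 2); (0, 3); (1, 0); (1, 3); (1, 2);
        (2, 3); (2, 0); (2, 1); (3, 2); (3, 1); (3, 0)]%N.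

Lemma alt4K i : (i < 12)%N -> alt4_index (alt4 i) = i.
Proof.
move=> i12; rewrite /alt4_index /alt4.
by do 12! [case: i i12 => [|i] i12;
  first by rewrite !permM /klein ?(expgS, expg0, mulg1, permM, permE) /=].
Qed.

Lemma alt4_even i : alt4 i \in ('Alt_('I_4))%g.
Proof.
have even2 (a b c d : 'I_4) : a != b -> c != d ->
    (tperm a b * tperm c d)%g \in ('Alt_('I_4))%g.
  by move=> ab cd; rewrite Alt_even odd_permM !odd_tperm ab cd.
by rewrite /alt4 /klein !groupM ?groupX ?even2.
Qed.

Lemma card_Alt4 : #|('Alt_('I_4))%g| = 12%N.
Proof.
have := @card_Alt 'I_4; rewrite card_ord => /(_ isT) E.
by apply/eqP; rewrite -(eqn_pmul2l (isT : 0 < 2)%N) E.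
Qed.

(** Moving the inverse power of [c3] to the left conjugates the Klein factor [l] times. The exponent
    [k + 2 * l] represents k - l modulo 3. Only [xor4 p q] remains of [p] and [q], whence the
    V-circulant shape. *)
Lemma alt4_divg k l p q : (k < 3)%N -> (l < 3)%N -> (p < 4)%N -> (q < 4)%N ->
  (alt4 (k + 3 * p) * (alt4 (l + 3 * q))^-1
   = c3 ^+ ((k + 2 * l) %% 3) * klein (iter l rot3 (xor4 p q)))%g.
Proof.
move=> k3 l3 p4 q4; rewrite /alt4.
have -> : ((k + 3 * p) %% 3 = k)%N by lia.
have -> : ((k + 3 * p) %/ 3 = p)%N by lia.
have -> : ((l + 3 * q) %% 3 = l)%N by lia.
have -> : ((l + 3 * q) %/ 3 = q)%N by lia.
rewrite invMg mulgA -[X in (X * _)%g = _]mulgA klein_divg //.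
rewrite -mulgA klein_c3V ?xor4_lt // mulgA; congr (_ * _)%g.
rewrite (expg_mod _ c3_order) expgD; congr (_ * _)%g.
by apply/eqP; rewrite eq_invg_mul -expgD addnC -mulSnr expgM c3_order expg1n.
Qed.

(** * Factorisation of the group determinant *)

Definition coset_sum (R : comNzRingType) (f : nat -> nat -> R) (k : nat) : R :=
  f k 0%N + f k 1%N + f k 2%N + f k 3%N.

Definition linear_part (R : comNzRingType) (f : nat -> nat -> R) : R :=
  let A := coset_sum f 0%N in
  let B := coset_sum f 1%N in
  let C := coset_sum f 2%N in
  A ^+ 3 + B ^+ 3 + C ^+ 3 - 3 * A * B * C.

(** The 3 x 3 determinant attached to a nontrivial character of V, expanded. The character advances
    cyclically with the column, so all three choices of starting character give this polynomial. *)
Definition cubic_part (R : comNzRingType) (f : nat -> nat -> R) : R :=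
  let chi1 k := f k 0%N + f k 1%N - f k 2%N - f k 3%N in
  let chi2 k := f k 0%N - f k 1%N - f k 2%N + f k 3%N in
  let chi3 k := f k 0%N - f k 1%N + f k 2%N - f k 3%N in
  chi1 0%N * chi2 0%N * chi3 0%N + chi1 1%N * chi2 1%N * chi3 1%N
  + chi1 2%N * chi2 2%N * chi3 2%N - chi1 0%N * chi2 1%N * chi3 2%N
  - chi3 0%N * chi1 1%N * chi2 2%N - chi2 0%N * chi3 1%N * chi1 2%N.

Lemma group_determinant_Alt4 (R : comNzRingType) (x : {perm 'I_4} -> R) :
  let f k p := x (alt4 (k + 3 * p)) in
  group_determinant ('Alt_('I_4))%G x = linear_part f * cubic_part f ^+ 3.
Proof.
move=> f.
have einj : injective (fun i : 'I_((3 + 3) + (3 + 3)) => alt4 i).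
  by move=> i j /(congr1 alt4_index); rewrite !alt4K // => /val_inj.
rewrite (group_determinant_enum x einj (fun i => alt4_even i) card_Alt4).
(* A table of k - l modulo 3, which reduces by computation. *)
pose diff3 (k l : nat) :=
  nth 0%N (nth [::] [:: [:: 0; 2; 1]; [:: 1; 0; 2]; [:: 2; 1; 0]] k)%N l.
have diff3E (k l : 'I_3) : ((k + 2 * l) %% 3)%N = diff3 k l.
  by case: k l => [[|[|[|//]]] ?] [[|[|[|//]]] ?].
pose F p k l := f (diff3 k l) (iter l rot3 p).
pose Z p : 'M[R]_3 := \matrix_(k, l) F p k l.
have entry p q (i j : 'I_3) a b : (p < 4)%N -> (q < 4)%N ->
    a = (i + 3 * p)%N -> b = (j + 3 * q)%N ->
    x (alt4 a * (alt4 b)^-1)%g = F (xor4 p q) i j.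
  move=> p4 q4 -> ->; rewrite alt4_divg // diff3E /F /f /alt4.
  have diff3_lt : (diff3 i j < 3)%N by rewrite -diff3E ltn_pmod.
  by congr (x (_ ^+ _ * klein _)%g); lia.
transitivity (\det (block_mx (block_mx (Z 0%N) (Z 1%N) (Z 1%N) (Z 0%N))
                      (block_mx (Z 2%N) (Z 3%N) (Z 3%N) (Z 2%N))
                      (block_mx (Z 2%N) (Z 3%N) (Z 3%N) (Z 2%N))
                      (block_mx (Z 0%N) (Z 1%N) (Z 1%N) (Z 0%N)))).
  congr (\det _); apply/matrixP => i j; rewrite mxE.
  case: (split_ordP i) => {}i ->; case: (split_ordP j) => {}j ->;
  case: (split_ordP i) => {}i ->; case: (split_ordP j) => {}j ->;
  rewrite ?(block_mxEul, block_mxEur, block_mxEdl, block_mxEdr) mxE.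
  - by apply: (entry 0%N 0%N); rewrite //=; lia.
  - by apply: (entry 0%N 1%N); rewrite //=; lia.
  - by apply: (entry 1%N 0%N); rewrite //=; lia.
  - by apply: (entry 1%N 1%N); rewrite //=; lia.
  - by apply: (entry 0%N 2%N); rewrite //=; lia.
  - by apply: (entry 0%N 3%N); rewrite //=; lia.
  - by apply: (entry 1%N 2%N); rewrite //=; lia.
  - by apply: (entry 1%N 3%N); rewrite //=; lia.
  - by apply: (entry 2%N 0%N); rewrite //=; lia.
  - by apply: (entry 2%N 1%N); rewrite //=; lia.
  - by apply: (entry 3%N 0%N); rewrite //=; lia.
  - by apply: (entry 3%N 1%N); rewrite //=; lia.
  - by apply: (entry 2%N 2%N); rewrite //=; lia.
  - by apply: (entry 2%N 3%N); rewrite //=; lia.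
  - by apply: (entry 3%N 2%N); rewrite //=; lia.
  - by apply: (entry 3%N 3%N); rewrite //=; lia.
rewrite det_klein_block.
rewrite (@det_mx33 _ (fun k l =>
    F 0%N k l + F 2%N k l + (F 1%N k l + F 3%N k l)));
  last by move=> i j; rewrite !mxE.
rewrite (@det_mx33 _ (fun k l =>
    F 0%N k l + F 2%N k l - (F 1%N k l + F 3%N k l)));
  last by move=> i j; rewrite !mxE.
rewrite (@det_mx33 _ (fun k l =>
    F 0%N k l - F 2%N k l + (F 1%N k l - F 3%N k l)));
  last by move=> i j; rewrite !mxE.
rewrite (@det_mx33 _ (fun k l =>
    F 0%N k l - F 2%N k l - (F 1%N k l - F 3%N k l)));
  last by move=> i j; rewrite !mxE.
rewrite {Z entry}/F /diff3 /= {F diff3 diff3E einj}.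
rewrite /linear_part /coset_sum /cubic_part /rot3 /=.
move: @f => f.
set D1 := _ - _ + _; set D2 := _ - _ + _.
set D3 := _ - _ + _; set D4 := _ - _ + _.
(* [D1] belongs to the trivial character of V, the other three to the nontrivial ones. *)
set L := _ - _ * _; set Q := _ - _ - _ - _.
have -> : D1 = L by rewrite /D1 /L; ring.
have -> : D2 = Q by rewrite /D2 /Q; ring.
have -> : D3 = Q by rewrite /D3 /Q; ring.
have -> : D4 = Q by rewrite /D4 /Q; ring.
by rewrite !exprS expr0 mulr1 !mulrA.
Qed.

Lemma integer_group_determinants_Alt4 d :
  integer_group_determinants ('Alt_('I_4))%G d <->
  exists f : nat -> nat -> int, d = linear_part f * cubic_part f ^+ 3.
Proof.
split=> [[x ->]|[f ->]].
  by eexists; apply: group_determinant_Alt4.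
pose x s := let i := alt4_index s in f (i %% 3)%N (i %/ 3)%N.
exists x; rewrite group_determinant_Alt4 /linear_part /cubic_part /coset_sum /x.
by rewrite !alt4K.
Qed.

(** * Divisibility by powers of 2 and 3 *)

(* On the coset k the nontrivial characters are S k - 2 a1 k, S k - 2 a2 k    *)
(* and S k - 2 a3 k, and a1 + a2 + a3 = 2 a is even: this turns the terms of  *)
(* first order into multiples of 4.                                           *)
Lemma cubic_part_modz4 (f : nat -> nat -> int) :
  exists w, linear_part f = cubic_part f + 4 * w.
Proof.
pose S := coset_sum f.
pose a1 k := f k 2%N + f k 3%N.
pose a2 k := f k 1%N + f k 2%N.
pose a3 k := f k 1%N + f k 3%N.
pose a k := f k 1%N + f k 2%N + f k 3%N.
pose own k := a k * S k ^+ 2 - (a1 k * a2 k + a2 k * a3 k + a3 k * a1 k) * S k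
  + 2 * (a1 k * a2 k * a3 k).
exists (own 0%N + own 1%N + own 2%N
  - (a 0%N * S 1%N * S 2%N + a 1%N * S 0%N * S 2%N + a 2%N * S 0%N * S 1%N)
  + ((a1 0%N * a2 1%N + a3 0%N * a1 1%N + a2 0%N * a3 1%N) * S 2%N
     + (a1 0%N * a3 2%N + a3 0%N * a2 2%N + a2 0%N * a1 2%N) * S 1%N
     + (a2 1%N * a3 2%N + a1 1%N * a2 2%N + a3 1%N * a1 2%N) * S 0%N)
  - 2 * (a1 0%N * a2 1%N * a3 2%N + a3 0%N * a1 1%N * a2 2%N
         + a2 0%N * a3 1%N * a1 2%N)).
rewrite /own /a /a1 /a2 /a3 /S /linear_part /cubic_part /coset_sum; ring.
Qed.

(** With s = A + B + C, the factorisation L = s (s^2 - 3 (AB + BC + CA)) shows L = s^3 mod 3. So 3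
    divides s, and then both factors. *)
Lemma dvdz9_linear_part (f : nat -> nat -> int) :
  (3 %| linear_part f)%Z -> (9 %| linear_part f)%Z.
Proof.
set A := coset_sum f 0%N; set B := coset_sum f 1%N; set C := coset_sum f 2%N.
have E : linear_part f
    = (A + B + C) * ((A + B + C) ^+ 2 - 3 * (A * B + B * C + C * A)).
  by rewrite /linear_part -/A -/B -/C; ring.
move=> d3; have /dvdzP[s sE] : (3 %| A + B + C)%Z.
  have : (3 %| (A + B + C) ^+ 3)%Z.
    have -> : (A + B + C) ^+ 3
        = linear_part f + 3 * ((A + B + C) * (A * B + B * C + C * A)).
      by rewrite E; ring.
    by rewrite rpredD ?dvdz_mulr.
  by rewrite !dvdzE abszX Euclid_dvdX // => /andP[].
apply/dvdzP; exists (s * (3 * s ^+ 2 - (A * B + B * C + C * A))).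
rewrite E sE; ring.
Qed.

Lemma int_pfactor (p : nat) (n : int) : prime p -> n != 0 ->
  exists e m, n = p%:Z ^+ e * m /\ ~~ (p %| m)%Z.
Proof.
move=> pp n0; have n_gt0 : (0 < `|n|)%N by rewrite absz_gt0.
have [m cm nE] := pfactor_coprime pp n_gt0.
exists (logn p `|n|), (sgz n * m%:Z); split.
  have nZ : `|n|%N%:Z = m%:Z * p%:Z ^+ logn p `|n|.
    by rewrite {1}nE PoszM -!natz natrX.
  by rewrite {1}[n]intEsg nZ mulrA mulrC.
by rewrite dvdzE abszM absz_sg n0 mul1n -prime_coprime.
Qed.

(** * Realisation of values by translation *)

(** A translation by t adds 12 t to A + B + C and fixes the cofactor A^2 + B^2 + C^2 - AB - BC - CA
    of L. The chosen vectors have cofactor 1 or 3, so L runs through a class modulo 12 or, when 9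
    divides [N], modulo 36. *)
Lemma integer_group_determinants_Alt4_cubic_part (N d : int) :
    ~~ (3 %| N)%Z \/ (9 %| N)%Z ->
    [\/ (N %% 4)%Z = 0 /\ d = 4, (N %% 4)%Z = 1 /\ d = 1
      | (N %% 4)%Z = 2 /\ d = 2] ->
  integer_group_determinants ('Alt_('I_4))%G (N * d ^+ 3).
Proof.
move=> N3 N4.
pose f (s : seq (seq int)) k p : int := nth 0 (nth [::] s k) p.
have shift (n0 q t : int) s :
    linear_part (fun k p => f s k p + t) = n0 + q * t -> cubic_part (f s) = d ->
    N = n0 + q * t ->
    integer_group_determinants ('Alt_('I_4))%G (N * d ^+ 3).
  move=> gE fE NE; apply/integer_group_determinants_Alt4.
  exists (fun k p => f s k p + t).
  by rewrite gE NE -fE /cubic_part; congr (_ * _ ^+ 3); ring.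
(* The vectors were found by a computer search; the values of t come from     *)
(* N = 4 N - 3 N and N = 9 N - 8 N.                                           *)
case: N3 => [N3|N9].
  have [N3r|N3r] : (N %% 3)%Z = 1 \/ (N %% 3)%Z = 2 by lia.
  - case: N4 => -[N4r dE].
    + by apply: (@shift 4 12 ((N %/ 3)%Z - (N %/ 4)%Z)
        [:: [:: 0; 0; 0; 1]; [:: 0; 0; 0; 1]; [:: 0; 1; 1; 0]]);
        [rewrite /linear_part /coset_sum /f /=; ring | rewrite dE | lia].
    + by apply: (@shift 1 12 ((N %/ 3)%Z - (N %/ 4)%Z)
        [:: [:: 0; 0; 0; 0]; [:: 0; 0; 0; 0]; [:: 0; 0; 0; 1]]);
        [rewrite /linear_part /coset_sum /f /=; ring | rewrite dE | lia].
    + by apply: (@shift (-2) 12 ((N %/ 3)%Z - (N %/ 4)%Z)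
        [:: [:: 0; 0; 0; 0]; [:: -1; 1; -1; 0]; [:: -1; 0; 0; 0]]);
        [rewrite /linear_part /coset_sum /f /=; ring | rewrite dE | lia].
  - case: N4 => -[N4r dE].
    + by apply: (@shift (-4) 12 ((N %/ 3)%Z - (N %/ 4)%Z + 1)
        [:: [:: -1; 0; 0; 0]; [:: -1; 1; -1; 0]; [:: 0; -1; -1; 0]]);
        [rewrite /linear_part /coset_sum /f /=; ring | rewrite dE | lia].
    + by apply: (@shift 5 12 ((N %/ 3)%Z - (N %/ 4)%Z)
        [:: [:: 0; 0; 0; 1]; [:: 0; 0; 1; 1]; [:: 0; 0; 1; 1]]);
        [rewrite /linear_part /coset_sum /f /=; ring | rewrite dE | lia].
    + by apply: (@shift 2 12 ((N %/ 3)%Z - (N %/ 4)%Z)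
        [:: [:: 0; 0; 0; 0]; [:: 0; 0; 0; 1]; [:: 0; 0; 0; 1]]);
        [rewrite /linear_part /coset_sum /f /=; ring | rewrite dE | lia].
case: N4 => -[N4r dE].
- by apply: (@shift 0 36 ((N %/ 4)%Z - 2 * (N %/ 9)%Z)
    [:: [:: -1; 0; 1; 0]; [:: 0; 0; 0; -1]; [:: 0; 1; 0; 0]]);
    [rewrite /linear_part /coset_sum /f /=; ring | rewrite dE | lia].
- by apply: (@shift 9 36 ((N %/ 4)%Z - 2 * (N %/ 9)%Z)
    [:: [:: 0; 0; 0; 0]; [:: 0; 0; 0; 1]; [:: 0; 0; 1; 1]]);
    [rewrite /linear_part /coset_sum /f /=; ring | rewrite dE | lia].
- by apply: (@shift 18 36 ((N %/ 4)%Z - 2 * (N %/ 9)%Z)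
    [:: [:: 0; 0; 0; 1]; [:: 0; 0; 1; 1]; [:: 0; 1; 1; 1]]);
    [rewrite /linear_part /coset_sum /f /=; ring | rewrite dE | lia].
Qed.

(** * Membership in the two sets and the final equality *)

Lemma coprimez6 (m : int) : (gcdz m 6 = 1) <-> ~~ (2 %| m)%Z /\ ~~ (3 %| m)%Z.
Proof.
have -> : (gcdz m 6 = 1) <-> coprime `|m| (2 * 3).
  by rewrite /coprime /gcdz; split=> [[->]|/eqP ->].
rewrite coprimeMr coprime_sym [coprime _ 3]coprime_sym !prime_coprime //.
by rewrite !dvdzE; split=> /andP.
Qed.

(** All factors 2 and 3 are extracted from [n]. An odd [n] leaves the exponent 4 unchanged, and an
    exponent of 3 equal to 1 contradicts the last hypothesis. *)
Lemma S_even_intro (a : nat) (n : int) :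
    a = 4%N /\ ~~ (2 %| n)%Z \/ (8 <= a)%N -> n != 0 ->
    ((3 %| n)%Z -> (9 %| n)%Z) ->
  S_even (2 ^+ a * n).
Proof.
move=> aP n0 n39.
have [e [n' [nE n'2]]] := int_pfactor (isT : prime 2) n0.
have n'0 : n' != 0 by apply: contraNneq n'2 => ->.
have [b [m [n'E m3]]] := int_pfactor (isT : prime 3) n'0.
exists (a + e)%N, b, m; split.
- case: aP => [[-> n2]|a8]; last by right; lia.
  case: e nE => [|e] nE; first by left.
  by move: n2; rewrite nE exprS -!mulrA dvdz_mulr.
- case: b n'E => [|[|b]] n'E; [by left | | by right].
  rewrite expr1 in n'E; have nE3 : n = 3 * (2 ^+ e * m).
    by rewrite nE n'E mulrCA.
  have /n39 : (3 %| n)%Z by rewrite nE3 dvdz_mulr.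
  rewrite nE3; set z := (_ ^+ e * _) => z9.
  have : (3 %| z)%Z by lia.
  rewrite dvdzE abszM abszX Euclid_dvdM // Euclid_dvdX //.
  by rewrite [X in _ || X](_ : _ = (3 %| m)%Z) // (negPf m3).
- apply/coprimez6; split=> //.
  by apply: contra n'2 => m2; rewrite n'E dvdz_mull.
- by rewrite nE n'E exprD !mulrA.
Qed.

Lemma linear_cubic_trichotomy (f : nat -> nat -> int) :
  let d := linear_part f * cubic_part f ^+ 3 in
  d = 0 \/ S_even d \/ S_odd d.
Proof.
move=> d; case: (eqVneq d 0) => [d0|d0]; [by left | right].
(* A factor 3 of Q is cubed in [d]; a factor 3 of L already brings 9. *)
have d39 : (3 %| d)%Z -> (9 %| d)%Z.
  move=> d3; have : (3 %| linear_part f)%Z \/ (3 %| cubic_part f)%Z.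
    apply/orP; move: d3; rewrite !dvdzE abszM abszX Euclid_dvdM //.
    by rewrite Euclid_dvdX // andbT.
  case=> [/dvdz9_linear_part|/dvdzP[q qE]]; first exact: dvdz_mulr.
  rewrite /d qE; apply/dvdzP; exists (linear_part f * q ^+ 3 * 3); ring.
have [w wE] := cubic_part_modz4 f.
set L := linear_part f in d d0 d39 wE *; set Q := cubic_part f in d d0 d39 wE *.
have [Q2|[Q2|Q2]] : (Q %% 2)%Z = 1 \/ (Q %% 4)%Z = 2 \/ (Q %% 4)%Z = 0 by lia.
- right; split.
    pose q := (Q %/ 2)%Z; have QE : Q = 2 * q + 1 by rewrite /q; lia.
    (* The first summand comes from Q^4 - 1 = (Q^2 - 1)(Q^2 + 1). *)
    have -> : d = 1
        + 4 * (2 * q * (q + 1) * (2 * q ^+ 2 + 2 * q + 1) + w * Q ^+ 3).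
      by rewrite /d wE QE; ring.
    lia.
  by case: (boolP (3 %| d)%Z) => [/d39|]; [right | left].
- pose q := (Q %/ 4)%Z; have QE : Q = 2 * (2 * q + 1) by rewrite /q; lia.
  (* L and Q are both twice an odd number. *)
  have dE : d = 2 ^+ 4 * ((2 * (q + w) + 1) * (2 * q + 1) ^+ 3).
    by rewrite /d wE QE; ring.
  left; rewrite dE; apply: S_even_intro.
  + left; split=> //.
    have -> : (2 * (q + w) + 1) * (2 * q + 1) ^+ 3
        = 1 + 2 * (q + w
          + (2 * (q + w) + 1) * (4 * q ^+ 3 + 6 * q ^+ 2 + 3 * q)).
      by ring.
    lia.
  + by apply: contraNneq d0 => z; rewrite dE z mulr0.
  + by move: d39; rewrite dE; set z := (_ * _ ^+ 3) => d39; lia.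
- pose q := (Q %/ 4)%Z; have QE : Q = 4 * q by rewrite /q; lia.
  (* L and Q are both multiples of 4. *)
  have dE : d = 2 ^+ 8 * ((q + w) * q ^+ 3).
    by rewrite /d wE QE; ring.
  left; rewrite dE; apply: S_even_intro.
  + by right.
  + by apply: contraNneq d0 => z; rewrite dE z mulr0.
  + by move: d39; rewrite dE; set z := (_ * _ ^+ 3) => d39; lia.
Qed.

Theorem theorem4p1 :
  (integer_group_determinants ('Alt_('I_4))%G
   = [set 0%R] `|` (S_even `|` S_odd))%classic.
Proof.
apply/seteqP; split=> [d /integer_group_determinants_Alt4[f ->]|d].
  by case: (linear_cubic_trichotomy f) => [|[|]];
    [left | right; left | right; right].
move=> [->|[|[d1 d3]]].
- apply/integer_group_determinants_Alt4; exists (fun _ _ => 0).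
  by rewrite /linear_part /coset_sum; ring.
- case=> a [b [m [aP bP /coprimez6[m2 m3] ->]]].
  have n3 k : ~~ (3 %| 2 ^+ k * 3 ^+ b * m)%Z \/ (9 %| 2 ^+ k * 3 ^+ b * m)%Z.
    case: bP => [->|b2]; [left | right].
      by rewrite mulr1 !dvdzE abszM abszX Euclid_dvdM // Euclid_dvdX // -!dvdzE.
    by rewrite dvdz_mulr // dvdz_mull // -(subnK b2) exprD dvdz_mull.
  case: aP => [->|a8].
    (* Q = 2 takes up 2^3, leaving L equal to twice an odd number. *)
    have -> : 2 ^+ 4 * 3 ^+ b * m = 2 ^+ 1 * 3 ^+ b * m * 2 ^+ 3 :> int by ring.
    apply: integer_group_determinants_Alt4_cubic_part; first exact: n3.
    apply: Or33; split=> //.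
    have : ~~ (2 %| 3 ^+ b * m)%Z.
      by rewrite dvdzE abszM abszX Euclid_dvdM // Euclid_dvdX // -!dvdzE.
    by rewrite -mulrA expr1; set z := 3 ^+ b * m; lia.
  (* Q = 4 takes up 2^6; since [a] is at least 8, the remaining L is a multiple of 4. *)
  have -> : 2 ^+ a * 3 ^+ b * m = 2 ^+ (a - 6) * 3 ^+ b * m * 4 ^+ 3 :> int.
    by rewrite -{1}(subnK (leq_trans (isT : 6 <= 8)%N a8)) exprD; ring.
  apply: integer_group_determinants_Alt4_cubic_part; first exact: n3.
  apply: Or31; split=> //; apply/dvdz_mod0P.
  have -> : (a - 6 = (a - 8).+2)%N by lia.
  by rewrite !exprS mulrA -!mulrA mulrA dvdz_mulr.
(* Here Q = 1 and L = [d]. *)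
- rewrite -[d]mulr1 -[1](expr1n _ 3).
  apply: integer_group_determinants_Alt4_cubic_part => //.
  by apply: Or32; split=> //; lia.
Qed.
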